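(* Let $u$ be the (sufficiently smooth) solution of $u'(t)+Au(t)+Bu(t)=f(t)$, $t\in(0,T]$, $u(0)=u^0$, let $U^n$, $n=2,\dots,N$, be the solution of the variable step-size BDF2 scheme $\bar\partial_B^2U^n+AU^n+BU^n=f^n$ ($n=2,\dots,N$) with starting approximations $U^0,U^1$, and let $e^n=u(t^n)-U^n$. Let $r_{\max}\le R$ with $1<R<R_1=(3+\sqrt{17})/2\approx3.561$, and let $c_R>\max\big\{\frac{2+2R}{2+R},\frac{2+2R}{2+3R-R^2}\big\}$. If $e^0=0$ and there exists a constant $c_1$ such that $k_{\max}$ satisfies $c_R\gamma^2k_{\max}\le c_1<1$, then for $n=2,3,\dots,N$ $$\|e\|^2_{l^2(t^2,t^n;V)}+\|e\|^2_{l^\infty(t^2,t^n;V)}\le C\Big(k_{\max}^4t^n+\frac1{k_1}|e^1|^2+\|e^1\|^2\Big).$$ Furthermore, if the starting value $U^1$ is computed by the trapezoidal scheme $$\frac{U^1-U^0}{k_1}+A\frac{U^1+U^0}2+B\frac{U^1+U^0}2=\frac{f^1+f^0}2$$ with $k_1<\frac3{\gamma^2(t^1)}$, then $$\|e\|^2_{l^2(t^1,t^n;V)}+\|e\|^2_{l^\infty(t^1,t^n;V)}\le C(k_{\max}^4+k_1^4).$$ Here $C$ depends on $t^n$ and the constants $\gamma,c_1,c_R,c_4,C_2$, with $$C_2=\frac{c_R}{1-c_1}\exp\Big(\frac{c_R}{1-c_1}\sum_{j=2}^n\gamma^2(t^j)k_j\Big).$$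
   Context: Let $(H,(\cdot,\cdot))$ be a Hilbert space with norm $|\cdot|$, and $A:D(A)\to H$ a positive definite, self-adjoint, linear operator with $D(A)$ dense in $H$. Let $V=D(A^{1/2})$ with norm $\|v\|=|A^{1/2}v|=(Av,v)^{1/2}$, and let $V^*$ be its dual, $V\subset H\subset V^*$, with norm $\|v\|_*=|A^{-1/2}v|$; $(\cdot,\cdot)$ also denotes the duality pairing between $V^*$ and $V$. $B$ is a linear operator with $|Bu|\le\gamma(t)\|u\|$ for all $u\in V$, $t\in J:=(0,T]$, where $\gamma:J\to\mathbb R$ is a smooth nonnegative function, and (without argument) $\gamma:=\max_{t\in J}\gamma(t)$. $f:[0,T]\to H$. Partition: $N\ge2$, $0=t^0<t^1<\dots<t^N=T$, $k_n=t^n-t^{n-1}$, $r_n=k_n/k_{n-1}$ and $s_n=r_n/(1+r_n)=k_n/(k_n+k_{n-1})$ for $n\ge2$; $k_{\max}=\max_{2\le n\le N}k_n$, $r_{\max}=\max_{2\le n\le N}r_n$; $f^n=f(t^n)$. Difference operators: $\bar\partial U^n=(U^n-U^{n-1})/k_n$ and $\bar\partial_B^2U^n=(1+s_n)\bar\partial U^n-s_n\bar\partial U^{n-1}$. The schemes are understood in variational form (tested with all $v\in V$), with $U^n\in V$ for $n\ge1$. The condition $k_1<3/\gamma^2(t^1)$ is void if $\gamma(t^1)=0$. Consistency errors: $d_2^n=\bar\partial_B^2u(t^n)-u'(t^n)$, $n\ge2$, and, with $v^{1/2}=(v^1+v^0)/2$ and $u^n=u(t^n)$, $d_2^1=\bar\partial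 u^1+Au^{1/2}+Bu^{1/2}-f^{1/2}$. $c_4$ is the constant (determined by derivatives of $u$) in the consistency bounds $|d_2^n|\le c_4k_n^2$ for $n\ge2$ and $\|d_2^1\|_*\le c_4k_1^2$. The solution $u$ is assumed regular enough for these bounds to hold. Norms: $\|e\|_{l^\infty(t^{n_1},t^{n_2};V)}=\max_{n_1\le j\le n_2}\|e^j\|$ and $\|e\|_{l^2(t^{n_1},t^{n_2};V)}=\big(\sum_{j=n_1}^{n_2}k_j\|e^j\|^2\big)^{1/2}$. *)

(* Defs.v *)
From HB Require Import structures.
From mathcomp Require Import all_boot all_order all_algebra.
From mathcomp Require Import sesquilinear.
From mathcomp Require Import all_classical all_reals all_analysis.

Set Implicit Arguments.
Unset Strict Implicit.
Unset Printing Implicit Defensive.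

Import Order.TTheory GRing.Theory Num.Theory.
Import numFieldNormedType.Exports.

Local Open Scope classical_set_scope.
Local Open Scope ring_scope.

(* A real Hilbert space is a complete normed module [H] with a positive
   definite symmetric form [dot : {dot H for idfun}] inducing its norm. *)
Definition induces_norm (R : realType) (H : completeNormedModType R)
    (dot : {dot H for idfun}) : Prop :=
  forall x : H, `|x| ^+ 2 = dot x x.

(* The values of [op] outside [dom] are irrelevant. *)
Record operator (R : realType) (H : normedModType R) := Operator {
  dom : set H;
  op :> H -> H;
  dom_zero : dom 0;
  dom_linear : forall (a : R) (x y : H), dom x -> dom y -> dom (a *: x + y);
  op_linear : forall (a : R) (x y : H), dom x -> dom y ->
    op (a *: x + y) = a *: op x + op y }.

Section Operators.
Context (R : realType) (H : completeNormedModType R).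
Implicit Types (dot : {dot H for idfun}) (A S B : operator H).

(* The right-hand condition inside [<->] says that [v] lies in the domain of
   the adjoint, with value [w]. *)
Definition self_adjoint dot A : Prop :=
  dense (dom A) /\
  forall v w : H,
    (dom A v /\ w = A v) <-> (forall x, dom A x -> dot (A x) v = dot x w).

Definition positive_definite dot A : Prop :=
  exists2 delta : R, 0 < delta &
    forall v, dom A v -> delta * `|v| ^+ 2 <= dot (A v) v.

(* [S] is the nonnegative self-adjoint square root of [A]; the space V is
   then [dom S]. *)
Definition is_sqrt_of dot A S : Prop :=
  [/\ self_adjoint dot S,
      forall v, dom S v -> 0 <= dot (S v) v,
      dom A = [set v | dom S v /\ dom S (S v)] &
      forall v, dom A v -> A v = S (S v)].

Definition normV S (v : H) : R := `|S v|.

(* Elements of V* are represented by functions [H -> R], of which only the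
   values on [dom S] matter; [h : H] is identified with [dot h].  The extension
   of A to V -> V* sends [w] to the following functional. *)
Definition extA dot S (w v : H) : R := dot (S w) (S v).

(* [z = S^-1 ell], for the extension to V* of S^-1 by duality, i.e.
   (S^-1 ell, x) = <ell, S^-1 x> for x in H, written with x = S v. *)
Definition is_inv_sqrt dot S (ell : H -> R) (z : H) : Prop :=
  forall v, dom S v -> dot z (S v) = ell v.

(* [ell] belongs to V* and its norm |A^{-1/2} ell| is at most [c]. *)
Definition dual_norm_le dot S (ell : H -> R) (c : R) : Prop :=
  exists2 z : H, is_inv_sqrt dot S ell z & `|z| <= c.

End Operators.

Section Derivatives.
Context (R : realType) (W : normedModType R).

(* [l] is the derivative of [g] at [t] relative to [D]
   (one-sided at the end points of an interval). *)
Definition is_derive_within (D : set R) (g : R -> W) (t : R) (l : W) : Prop :=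
  (fun s => (s - t)^-1 *: (g s - g t)) @ within (D `\ t) (nbhs t) --> l.

Definition smooth_on (D : set R) (g : R -> W) : Prop :=
  exists2 G : nat -> R -> W, (forall t, D t -> G 0%N t = g t) &
    forall n t, D t -> is_derive_within D (G n) t (G n.+1 t).

End Derivatives.

Section Grid.
Context (R : realType).
Implicit Types (t : nat -> R) (N n j : nat).

Definition partition_of (T : R) N t : Prop :=
  [/\ (2 <= N)%N, t 0%N = 0, t N = T & forall n, (n < N)%N -> t n < t n.+1].

Definition step t n : R := t n - t n.-1.
Definition ratio t n : R := step t n / step t n.-1.
Definition weight t n : R := ratio t n / (1 + ratio t n).

(* The maxima below range over nonnegative quantities, so that the default
   value 0 is harmless. *)
Definition kmax t N : R := \big[Num.max/0]_(2 <= n < N.+1) step t n.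
Definition rmax t N : R := \big[Num.max/0]_(2 <= n < N.+1) ratio t n.

Definition C2 (gamma : R -> R) t (cR c1 : R) n : R :=
  cR / (1 - c1) *
  expR (cR / (1 - c1) * \sum_(2 <= j < n.+1) gamma (t j) ^+ 2 * step t j).

End Grid.

Section Schemes.
Context (R : realType) (H : completeNormedModType R).
Implicit Types (dot : {dot H for idfun}) (S B : operator H).
Implicit Types (t : nat -> R) (U e : nat -> H) (u f : R -> H) (n j N : nat).

Definition dbar t U n : H := (step t n)^-1 *: (U n - U n.-1).

Definition dbarB2 t U n : H :=
  (1 + weight t n) *: dbar t U n - weight t n *: dbar t U n.-1.

Definition midpoint (x y : H) : H := 2^-1 *: (x + y).

(* [du] plays the role of u'; the equation is an identity in V*. *)
Definition is_solution dot S B (T : R) f u du : Prop :=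
  [/\ {within `[0, T], continuous u},
      forall s, s \in `]0, T] -> dom S (u s),
      forall s, s \in `]0, T] -> is_derive_within `[0, T] u s (du s) &
      forall s, s \in `]0, T] -> forall v, dom S v ->
        dot (du s) v + extA dot S (u s) v + dot (B (u s)) v = dot (f s) v].

Definition bdf2_scheme dot S B t f N U : Prop :=
  forall n, (2 <= n <= N)%N -> forall v, dom S v ->
    dot (dbarB2 t U n) v + extA dot S (U n) v + dot (B (U n)) v
    = dot (f (t n)) v.

Definition trapezoidal_step dot S B t f U : Prop :=
  forall v, dom S v ->
    dot (dbar t U 1) v + extA dot S (midpoint (U 1%N) (U 0%N)) v
      + dot (B (midpoint (U 1%N) (U 0%N))) v
    = dot (midpoint (f (t 1%N)) (f (t 0%N))) v.

Definition d2 t u du n : H := dbarB2 t (u \o t) n - du (t n).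

(* The consistency error of the trapezoidal step, an element of V*. *)
Definition d21 dot S B t f u (v : H) : R :=
  dot (dbar t (u \o t) 1) v
  + extA dot S (midpoint (u (t 1%N)) (u (t 0%N))) v
  + dot (B (midpoint (u (t 1%N)) (u (t 0%N)))) v
  - dot (midpoint (f (t 1%N)) (f (t 0%N))) v.

Definition linftyV S e n1 n2 : R :=
  \big[Num.max/0]_(n1 <= j < n2.+1) normV S (e j).

Definition l2V S t e n1 n2 : R :=
  Num.sqrt (\sum_(n1 <= j < n2.+1) step t j * normV S (e j) ^+ 2).

End Schemes.

(* Main.v *)
(* Testing the error equation with 2 k_n dbar e^n, and splitting the coupling
   term 2 s_n k_n (dbar e^n, dbar e^{n-1}) by Young's inequality with weight r_n,
   bounds the quadratic form of the BDF2 operator from below by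
   k_n (2 + 2 s_n - s_n r_n) |dbar e^n|^2 - k_{n-1} s_n |dbar e^{n-1}|^2.
   With sigma = R / (1 + R) >= s_n, the lower bound on c_R says exactly that
   2 + 2 s_n - s_n r_n >= sigma + 2 / c_R, and the excess 2 / c_R absorbs the
   contributions of B and of the consistency error.  The energy
   E_n = ||e^n||^2 + sigma k_n |dbar e^n|^2 therefore satisfies
   E_n <= E_{n-1} + c_R gamma^2(t^n) k_n E_n + c_R k_n |d_2^n|^2, to which a
   discrete Gronwall inequality applies; since e^0 = 0, E_1 consists of the two
   starting error terms.  For the trapezoidal step these are bounded by testing
   its error equation with e^1. *)

Require Import Defs.
From HB Require Import structures.
From mathcomp Require Import all_boot all_order all_algebra.
From mathcomp Require Import sesquilinear.
From mathcomp Require Import all_classical all_reals all_analysis.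
From mathcomp Require Import ring lra zify.

Set Implicit Arguments.
Unset Strict Implicit.
Unset Printing Implicit Defensive.

Import Order.TTheory GRing.Theory Num.Theory.
Import numFieldNormedType.Exports.

Local Open Scope classical_set_scope.
Local Open Scope ring_scope.

(** * Linearity of partially defined operators on their domains *)

Section OperatorLinearity.
Context (R : realType) (H : normedModType R) (A : operator H).

Lemma op0 : A 0 = 0.
Proof.
have := op_linear 1 (dom_zero A) (dom_zero A).
by rewrite !scale1r addr0 => /(congr1 (fun z => z - A 0)); rewrite addrK subrr.
Qed.

Lemma domZ a x : dom A x -> dom A (a *: x).
Proof. by move=> Ax; rewrite -[_ *: _]addr0; exact: dom_linear (dom_zero A). Qed.

Lemma opZ a x : dom A x -> A (a *: x) = a *: A x.
Proof.
by move=> Ax; rewrite -[a *: x]addr0 op_linear ?op0 ?addr0//; exact: dom_zero.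
Qed.

Lemma domB x y : dom A x -> dom A y -> dom A (x - y).
Proof. by move=> Ax Ay; rewrite addrC -scaleN1r; exact: dom_linear. Qed.

Lemma opB x y : dom A x -> dom A y -> A (x - y) = A x - A y.
Proof.
by move=> Ax Ay; rewrite addrC -scaleN1r op_linear// scaleN1r addrC.
Qed.

End OperatorLinearity.

(** * Energy estimates for a single time step *)

Section Energy.
Context (R : realType) (H : completeNormedModType R) (dot : {dot H for idfun}).
Context (dotn : induces_norm dot).

Lemma dotC x y : dot x y = dot y x.
Proof. by rewrite hermC expr0 mul1r. Qed.

Lemma norm2B x y : `|x - y| ^+ 2 = `|x| ^+ 2 + `|y| ^+ 2 - 2 * dot x y.
Proof.
rewrite !dotn linearBl/= !linearBr/= [dot y x]dotC; ring.
Qed.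

(** Young's inequality: expand [|c x - y|^2 >= 0] and divide by [c]. *)
Lemma two_dot_le c x y : 0 < c -> 2 * dot x y <= c * `|x| ^+ 2 + `|y| ^+ 2 / c.
Proof.
move=> c0; have := sqr_ge0 `|c *: x - y|.
rewrite norm2B normrZ (gtr0_norm c0) linearZl_LR/= => h.
rewrite -subr_ge0 -(pmulr_rge0 _ c0); apply: le_trans h _.
rewrite le_eqVlt; apply/orP; left; apply/eqP; field; lra.
Qed.

(** Here [x], [x'] stand for e^n, e^{n-1}, [y], [y'] for their backward difference quotients, [k],
    [k'] for the steps and [d] for the consistency error. Testing with [y] is allowed, since [y] is
    a multiple of [x - x'] and so lies in V. *)
Lemma bdf2_energy_step (S B : operator H) (k k' r s sigma cR g : R)
    (x x' y y' d : H) :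
  0 < k' -> 0 < r -> k = r * k' -> s <= sigma ->
  0 < cR -> sigma + 2 / cR <= 2 + 2 * s - s * r ->
  0 <= s -> dom S x -> dom S x' -> x - x' = k *: y ->
  `|B x| <= g * `|S x| ->
  (forall v, dom S v ->
    dot ((1 + s) *: y - s *: y') v + dot (S x) (S v) + dot (B x) v = dot d v) ->
  `|S x| ^+ 2 + sigma * (k * `|y| ^+ 2) <=
  `|S x'| ^+ 2 + sigma * (k' * `|y'| ^+ 2)
  + cR * g ^+ 2 * k * `|S x| ^+ 2 + cR * k * `|d| ^+ 2.
Proof.
move=> k'0 r0 kE ssig cR0 sigP s0 Sx Sx' xx' Bx eqv.
have k0 : 0 < k by rewrite kE mulr_gt0.
have yE : y = k^-1 *: (x - x') by rewrite xx' scalerA mulVf ?gt_eqF// scale1r.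
have Sy : dom S y by rewrite yE; apply/domZ/domB.
have testy := eqv _ Sy; rewrite linearBl/= !linearZl_LR/= -dotn in testy.
have SyE : k * dot (S x) (S y) = `|S x| ^+ 2 - dot (S x) (S x').
  rewrite yE opZ ?opB//; last exact: domB.
  by rewrite linearZr_LR/= mulrA mulfV ?gt_eqF// mul1r linearBr/= -dotn.
have SB := sqr_ge0 `|S x - S x'|; rewrite norm2B in SB.
(* With weight [cR^-1] the B term and the consistency term each cost [|y|^2 / cR], together the
   [2 / cR] set aside in the hypothesis on [sigma]. Weight [r] in [yy'] trades the step [k] for
   [k' = k / r], which produces the previous energy. *)
have cV0 : 0 < cR^-1 by rewrite invr_gt0.
have yB := two_dot_le (- y) (B x) cV0.
have yd := two_dot_le y d cV0.
have yy' := two_dot_le y y' r0.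
rewrite linearNl/= normrN invrK dotC in yB.
rewrite invrK dotC in yd; rewrite dotC in yy'.
have B2 : `|B x| ^+ 2 <= g ^+ 2 * `|S x| ^+ 2.
  by rewrite -exprMn lerXn2r// ?nnegrE// (le_trans _ Bx).
have kr : k / r = k' by rewrite kE mulrAC mulfV ?gt_eqF// mul1r.
have {}yB := ler_wpM2l (ltW k0) yB.
have {}yd := ler_wpM2l (ltW k0) yd.
have {}yy' := ler_wpM2l (mulr_ge0 (ltW k0) s0) yy'.
have yy'E : k * s * (`|y'| ^+ 2 / r) = s * (k' * `|y'| ^+ 2).
  by rewrite -kr; ring.
have {}B2 := ler_wpM2l (ltW (mulr_gt0 k0 cR0)) B2.
have {}sigP := ler_wpM2l (mulr_ge0 (ltW k0) (sqr_ge0 `|y|)) sigP.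
have {}ssig := ler_wpM2r (mulr_ge0 (ltW k'0) (sqr_ge0 `|y'|)) ssig.
have {}testy : 2 * k * ((1 + s) * `|y| ^+ 2 - s * dot y' y + dot (S x) (S y) +
   dot (B x) y) = 2 * k * dot d y by rewrite testy.
rewrite mulrDr yy'E in yy'.
move: (cR^-1) yB yd sigP => icR yB yd sigP.
lra.
Qed.

(** Here [x] is e^1 and [z] represents A^{-1/2} d_2^1. The factors 1/2 in the tested equation arise
    because e^0 = 0 makes the midpoint error e^1/2. *)
Lemma trapezoidal_error_bound (S B : operator H) (k g c : R) (x z : H) :
  0 < k -> 0 <= g -> `|B x| <= g * `|S x| ->
  (g != 0 -> k < 3 / g ^+ 2) -> `|z| <= c * k ^+ 2 ->
  k^-1 * `|x| ^+ 2 + 2^-1 * `|S x| ^+ 2 + 2^-1 * dot (B x) x = dot z (S x) ->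
  k^-1 * `|x| ^+ 2 + `|S x| ^+ 2 <= 16 * c ^+ 2 * k ^+ 4.
Proof.
move=> k0 g0 Bx kg zc eqx.
have kg2 : k * g ^+ 2 <= 3.
  have [->|gn0] := eqVneq g 0; first by rewrite expr0n/= mulr0.
  by rewrite ltW// -ltr_pdivlMr ?kg// exprn_gt0// lt_def gn0.
have k30 : 0 < 3 / k by rewrite divr_gt0.
have q0 : 0 < 4^-1 :> R by rewrite invr_gt0.
(* this weight turns k g^2 <= 3 into the bound |Sx|^2 / 4 for the B term *)
have yB := two_dot_le (- x) (B x) k30.
have yz := two_dot_le (S x) z q0.
rewrite linearNl/= normrN dotC invf_div in yB.
rewrite dotC invrK in yz.
have B2 : `|B x| ^+ 2 <= g ^+ 2 * `|S x| ^+ 2.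
  by rewrite -exprMn lerXn2r// ?nnegrE// (le_trans _ Bx).
have z2 : `|z| ^+ 2 <= c ^+ 2 * k ^+ 4.
  by rewrite (exprM k 2 2) -exprMn lerXn2r// ?nnegrE// (le_trans _ zc).
have {}B2 := ler_wpM2l (ltW k0) B2.
have {}kg2 := ler_wpM2r (sqr_ge0 `|S x|) kg2.
(* The Young bounds leave [|x|^2 / (4 k) + |S x|^2 / 8 <= 2 |z|^2]. Multiplying by 8 gives the
   constant 16, and [xk] drops the surplus [|x|^2 / k]. *)
have xk : 0 <= k^-1 * `|x| ^+ 2 by rewrite mulr_ge0// ?invr_ge0 ltW.
move: (k^-1) yB xk eqx => ik yB xk eqx.
lra.
Qed.

End Energy.

(** * Scalar inequalities: the step ratio condition and Gronwall *)

(** The two entries of the maximum are the conditions on [cR] that the inequality imposes at [r = 0]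
    and at [r = Rb]; [h1] and [h2] below express them. *)
Lemma weight_bound (R : realType) (r Rb cR : R) :
  0 < r -> r <= Rb -> 1 < Rb -> Rb < (3 + Num.sqrt 17) / 2 ->
  Num.max ((2 + 2 * Rb) / (2 + Rb))
          ((2 + 2 * Rb) / (2 + 3 * Rb - Rb ^+ 2)) < cR ->
  0 < cR /\ Rb / (1 + Rb) + 2 / cR <=
    2 + 2 * (r / (1 + r)) - r / (1 + r) * r.
Proof.
move=> r0 rR R1 R17; rewrite gt_max => /andP[c1 c2].
have s0 : 0 <= Num.sqrt 17 :> R by exact: sqrtr_ge0.
have s2 : Num.sqrt 17 ^+ 2 = 17 :> R by rewrite sqr_sqrtr.
move: (Num.sqrt 17) s0 s2 R17 => q s0 s2 R17.
have q1 : 1 < q by rewrite ltNge; apply/negP => ?; nra.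
(* The bound on [Rb] is the positive root of this quadratic, as
   [4 (2 + 3 Rb - Rb^2) = 17 - (2 Rb - 3)^2]. *)
have q0 : 0 < 2 + 3 * Rb - Rb ^+ 2.
  have : 0 < (q - (2 * Rb - 3)) * (q + (2 * Rb - 3)) by apply: mulr_gt0; lra.
  nra.
have p0 : 0 < 2 + Rb by lra.
have n0 : 0 < 2 + 2 * Rb by lra.
have cR0 : 0 < cR by rewrite (lt_trans _ c1)// divr_gt0.
split=> //; move: c1 c2; rewrite !ltr_pdivrMr// => c1 c2.
have Rb0 : 0 < 1 + Rb by lra.
have r10 : 0 < 1 + r by lra.
have h1 : Rb / (1 + Rb) + 2 / cR <= 2.
  rewrite -lerBrDl ler_pdivrMr//.
  have -> : 2 - Rb / (1 + Rb) = (2 + Rb) / (1 + Rb) by field; lra.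
  rewrite mulrAC ler_pdivlMr//; lra.
have h2 : Rb / (1 + Rb) + 2 / cR <= (2 + 4 * Rb - Rb ^+ 2) / (1 + Rb).
  rewrite -lerBrDl ler_pdivrMr//.
  rewrite -mulrBl mulrAC ler_pdivlMr//; nra.
have -> : 2 + 2 * (r / (1 + r)) - r / (1 + r) * r
    = (2 + 4 * r - r ^+ 2) / (1 + r) by field; lra.
(* a concave function of r, hence minimal at an end point of [0, Rb] *)
have [r2|r2] := leP r 2.
  (* The cut is at 2 because the function equals 2 both at [r = 0] and at [r = 2], and decreases
     from there on. *)
  apply: le_trans h1 _; rewrite ler_pdivlMr//; nra.
apply: le_trans h2 _; rewrite ler_pdivrMr// mulrAC ler_pdivlMr//.
rewrite -subr_ge0.
have -> : (2 + 4 * r - r ^+ 2) * (1 + Rb) - (2 + 4 * Rb - Rb ^+ 2) * (1 + r)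
  = (Rb - r) * ((1 + r) * (1 + Rb) - 3) by ring.
apply: mulr_ge0; nra.
Qed.

(** The recursion is implicit, so each step costs a factor [1 / (1 - x j)]. As [x j <= c < 1], this
    is at most the exponential of [x j / (1 - c)], and the factors multiply to the exponential of
    the sum. *)
Lemma discrete_gronwall (R : realType) (E x g : nat -> R) (c : R) m n :
  (m <= n)%N -> c < 1 -> 0 <= E m ->
  (forall j, (m < j <= n)%N ->
    [/\ 0 <= x j, x j <= c, 0 <= g j & E j <= E j.-1 + x j * E j + g j]) ->
  E n <= expR ((1 - c)^-1 * \sum_(m.+1 <= j < n.+1) x j)
         * (E m + \sum_(m.+1 <= j < n.+1) g j).
Proof.
move=> + c1 E0; elim: n => [|n IH].
  by rewrite leqn0 => /eqP-> _; rewrite !big_geq// mulr0 expR0 mul1r addr0.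
rewrite leq_eqVlt => /predU1P[-> _|].
  by rewrite !big_geq// mulr0 expR0 mul1r addr0.
rewrite ltnS => mn rec.
have x0g j : (m < j <= n)%N -> 0 <= x j /\ 0 <= g j.
  by move=> hj; case: (rec j ltac:(lia)).
have {}IH := IH mn (fun j (hj : (m < j <= n)%N) => rec j ltac:(lia)).
have [x0 xc g0 /= En] := rec n.+1 ltac:(lia).
rewrite !(@big_nat_recr _ _ _ n.+1)/= ?ltnS// [(1 - c)^-1 * _]mulrDr expRD.
set X := expR _ in IH *; set G := \sum_(_ <= _ < _) g _ in IH *.
have c0 : 0 < 1 - c by lra.
have X1 : 1 <= X.
  rewrite -expR0 ler_expR mulr_ge0 ?invr_ge0 ?(ltW c0)// big_nat_cond sumr_ge0//.
  by move=> j; rewrite andbT => /x0g[].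
(* 1 <= (1 - x) (1 + x / (1 - c)) for 0 <= x <= c *)
have Y1 : 1 <= (1 - x n.+1) * expR ((1 - c)^-1 * x n.+1).
  have := expR_ge1Dx ((1 - c)^-1 * x n.+1).
  move/(ler_wpM2l (_ : 0 <= 1 - x n.+1)); rewrite subr_ge0.
  move=> /(_ ltac:(lra)); apply: le_trans.
  have q : x n.+1 <= (1 - x n.+1) * ((1 - c)^-1 * x n.+1).
    rewrite mulrA ler_peMl// ler_pdivlMr//; lra.
  lra.
set Y := expR _ in Y1 *.
have Y0 : 0 < Y := expR_gt0 _.
have h : (1 - x n.+1) * E n.+1 <= X * (E m + (G + g n.+1)).
  apply: (@le_trans _ _ (E n + g n.+1)); first lra.
  apply: le_trans (lerD IH (ler_peMl g0 X1)) _; lra.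
(* [Y1] can be multiplied by [E n.+1] only when that is nonnegative; otherwise the claim holds
   because its right-hand side is nonnegative. *)
have [En0|En0] := leP (E n.+1) 0; last nra.
have X0 : 0 < X := expR_gt0 _.
apply: le_trans En0 _; apply: mulr_ge0; first exact: mulr_ge0 (ltW X0) (ltW Y0).
rewrite addr_ge0// addr_ge0// /G big_nat_cond sumr_ge0//.
by move=> j; rewrite andbT => /x0g[].
Qed.

(** * The partition: steps, ratios and difference quotients *)

Section GridBounds.
Context (R : realType) (t : nat -> R).

Lemma grid_lt N i j : (forall n, (n < N)%N -> t n < t n.+1) ->
  (i < j <= N)%N -> t i < t j.
Proof.
move=> tS; elim: j => // j IH /andP[ij jN].
have tj := tS j jN; move: ij; rewrite ltnS leq_eqVlt => /predU1P[->//|ij].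
by apply: lt_trans tj; apply: IH; rewrite ij ltnW.
Qed.

Lemma sum_step_le m n : (0 < m)%N -> t 0%N = 0 ->
  (forall j, (j < n)%N -> t j < t j.+1) ->
  \sum_(m <= j < n.+1) step t j <= t n.
Proof.
move=> m0 t0; elim: n => [|n IH] tS; first by rewrite big_geq// t0.
have [mn|nm] := leqP m n.+1.
  rewrite big_nat_recr//= {2}/step/=.
  have := IH (fun j jn => tS j (ltnW jn)); lra.
by rewrite big_geq// -t0 ltW// (grid_lt tS)// leqnn.
Qed.

Lemma step_le_kmax N n : (2 <= n <= N)%N -> step t n <= kmax t N.
Proof.
move=> nN; apply: (le_bigmax_seq 0 n xpredT) => //.
by rewrite mem_index_iota ltnS.
Qed.

Lemma ratio_le_rmax N n : (2 <= n <= N)%N -> Defs.ratio t n <= rmax t N.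
Proof.
move=> nN; apply: (le_bigmax_seq 0 n xpredT) => //.
by rewrite mem_index_iota ltnS.
Qed.

End GridBounds.

Section DifferenceOperators.
Context (R : realType) (H : completeNormedModType R) (t : nat -> R).
Implicit Types a b : nat -> H.

Lemma dbarB a b n : dbar t (fun i => a i - b i) n = dbar t a n - dbar t b n.
Proof. by rewrite /dbar -scalerBr opprD addrACA -opprD. Qed.

Lemma dbarB2B a b n :
  dbarB2 t (fun i => a i - b i) n = dbarB2 t a n - dbarB2 t b n.
Proof. by rewrite /dbarB2 !dbarB !scalerBr opprD addrACA -opprD. Qed.

End DifferenceOperators.

(** * Passage to the discrete norms and stability of BDF2 *)

(** The steps sum to at most [t n], so a bound uniform in [j] controls both norms at once and only
    pointwise estimates remain to be proved. *)
Lemma l2V_linftyV_le (R : realType) (H : completeNormedModType R)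
    (S : operator H) (t : nat -> R) (e : nat -> H) (M : R) (m n : nat) :
  (0 < m)%N -> t 0%N = 0 -> (forall j, (j < n)%N -> t j < t j.+1) -> 0 <= M ->
  (forall j, (m <= j <= n)%N -> `|S (e j)| ^+ 2 <= M) ->
  l2V S t e m n ^+ 2 + linftyV S e m n ^+ 2 <= (1 + t n) * M.
Proof.
move=> m0 t0 tS M0 eM; rewrite /l2V /linftyV.
have k0 j : (m <= j < n.+1)%N -> 0 <= step t j.
  move=> jn; rewrite subr_ge0 ltW//; have := tS j.-1 ltac:(lia).
  by rewrite prednK//; lia.
have sumM : \sum_(m <= j < n.+1) step t j * normV S (e j) ^+ 2 <= t n * M.
  apply: le_trans (ler_wpM2r M0 (sum_step_le m0 t0 tS)).
  rewrite mulr_suml !big_nat ler_sum// => j jn.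
  by rewrite ler_wpM2l ?k0// eM.
rewrite sqr_sqrtr; last first.
  by rewrite big_nat sumr_ge0// => j jn; rewrite mulr_ge0 ?k0// sqr_ge0.
rewrite addrC mulrDl mul1r lerD//.
set L := (X in X ^+ 2); have L0 : 0 <= L by rewrite /L; apply: bigmax_ge_id.
rewrite -[leRHS](sqr_sqrtr M0) lerXn2r ?nnegrE ?sqrtr_ge0//.
rewrite /L big_nat_cond bigmax_le ?sqrtr_ge0// => j; rewrite andbT => jn.
by have := ler_wsqrtr (eM j jn); rewrite sqrtr_sqr normr_id.
Qed.

(** Stability for any sequence [e] that solves the scheme with residual [d]. The bound at [j]
    carries the sums up to [n], which makes it uniform in [j <= n], as the maximum norm requires. *)
Lemma bdf2_stability (R : realType) (H : completeNormedModType R)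
    (dot : {dot H for idfun}) (S B : operator H) (T : R) (N : nat)
    (t g : nat -> R) (Rb cR c1 c G : R) (e d : nat -> H) (n j : nat) :
  induces_norm dot -> partition_of T N t ->
  1 < Rb -> Rb < (3 + Num.sqrt 17) / 2 -> rmax t N <= Rb ->
  Num.max ((2 + 2 * Rb) / (2 + Rb))
          ((2 + 2 * Rb) / (2 + 3 * Rb - Rb ^+ 2)) < cR ->
  cR * G ^+ 2 * kmax t N <= c1 -> c1 < 1 ->
  (forall i, (2 <= i <= N)%N -> 0 <= g i <= G) ->
  (forall i, (2 <= i <= N)%N -> `|B (e i)| <= g i * `|S (e i)|) ->
  (forall i, (2 <= i <= N)%N -> `|d i| <= c * step t i ^+ 2) ->
  (forall i, (1 <= i <= N)%N -> dom S (e i)) -> e 0%N = 0 ->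
  (forall i, (2 <= i <= N)%N -> forall v, dom S v ->
    dot (dbarB2 t e i) v + extA dot S (e i) v + dot (B (e i)) v = dot (d i) v) ->
  (2 <= j <= n)%N -> (n <= N)%N ->
  `|S (e j)| ^+ 2 <=
  expR (cR / (1 - c1) * \sum_(2 <= i < n.+1) g i ^+ 2 * step t i)
  * (1 + cR * c ^+ 2)
  * (kmax t N ^+ 4 * t n + (step t 1)^-1 * `|e 1%N| ^+ 2 + `|S (e 1%N)| ^+ 2).
Proof.
move=> dotn [N2 t0 _ tS] R1 R17 rR maxc cG c11 gG Be dc Se e0 eqe /andP[j2 jn] nN.
have k0 i : (1 <= i <= N)%N -> 0 < step t i.
  move=> iN; rewrite subr_gt0; have := tS i.-1 ltac:(clear -iN; lia).
  by rewrite prednK//; clear -iN; lia.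
have lt1 i : (2 <= i <= N)%N -> (1 <= i <= N)%N by case/andP => /ltnW->.
have ltp i : (2 <= i <= N)%N -> (1 <= i.-1 <= N)%N by clear; lia.
have ltj i : (1 < i <= j)%N -> (2 <= i <= N)%N by clear -jn nN; lia.
have ltn i : (1 < i < n.+1)%N -> (1 <= i <= N)%N by clear -nN; lia.
have l11 : (1 <= 1 <= N)%N by rewrite leqnn ltnW.
have j1 : (1 <= j)%N by rewrite ltnW.
have n0 : (0 < n)%N by rewrite (leq_trans j1).
have r0 i : (2 <= i <= N)%N -> 0 < Defs.ratio t i.
  by move=> iN; apply: divr_gt0; apply: k0; [exact: lt1|exact: ltp].
have rRb i : (2 <= i <= N)%N -> Defs.ratio t i <= Rb.
  by move=> iN; exact: le_trans (ratio_le_rmax t iN) rR.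
have wB i (iN : (2 <= i <= N)%N) := weight_bound (r0 i iN) (rRb i iN) R1 R17 maxc.
have [cR0 _] := wB 2 N2.
have K0 : 0 <= kmax t N by exact: bigmax_ge_id.
pose sigma := Rb / (1 + Rb).
have sig0 : 0 <= sigma by rewrite divr_ge0//; lra.
have sig1 : sigma <= 1 by rewrite ler_pdivrMr; lra.
pose E i := `|S (e i)| ^+ 2 + sigma * (step t i * `|dbar t e i| ^+ 2).
(* [x] is the coefficient of the implicit term, kept below [c1] by the step restriction; [y] bounds
   the consistency contribution through [|d i| <= c * kmax^2]. *)
pose x i := cR * (g i ^+ 2 * step t i).
pose y i := cR * c ^+ 2 * kmax t N ^+ 4 * step t i.
have SE i : (1 <= i <= N)%N -> `|S (e i)| ^+ 2 <= E i.
  by move=> iN; rewrite lerDl mulr_ge0// mulr_ge0// ltW// k0.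
have E10 : 0 <= E 1%N by apply: le_trans (SE 1%N l11).
have rec i : (1 < i <= j)%N ->
    [/\ 0 <= x i, x i <= c1, 0 <= y i & E i <= E i.-1 + x i * E i + y i].
  move=> ij; have iN := ltj i ij.
  have ki := k0 i (lt1 i iN); have kp := k0 i.-1 (ltp i iN).
  have kK := step_le_kmax t iN; have /andP[g0 gGi] := gG i iN.
  have x0 : 0 <= x i by rewrite mulr_ge0 ?(ltW cR0)// mulr_ge0// ?sqr_ge0// ltW.
  have G2 : g i ^+ 2 <= G ^+ 2 by rewrite lerXn2r// nnegrE// (le_trans g0).
  split=> //.
  - apply: le_trans cG; rewrite /x -mulrA ler_wpM2l ?(ltW cR0)//.
    by rewrite ler_pM ?sqr_ge0// ltW.
  - by rewrite mulr_ge0 ?(ltW ki)// mulr_ge0 ?exprn_ge0// mulr_ge0 ?sqr_ge0// ltW.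
  have [_ wi] := wB i iN.
  have kE : step t i = Defs.ratio t i * step t i.-1.
    by rewrite /Defs.ratio divfK ?gt_eqF.
  have w0 : 0 <= weight t i.
    by rewrite divr_ge0 ?addr_ge0// ltW// r0.
  have wsig : weight t i <= sigma.
    rewrite /weight /sigma; have := r0 i iN; have := rRb i iN => rr rp.
    rewrite ler_pdivrMr; last lra.
    rewrite mulrAC ler_pdivlMr; lra.
  have eE : e i - e i.-1 = step t i *: dbar t e i.
    by rewrite scalerA mulfV ?scale1r// gt_eqF.
  have Sep : dom S (e i.-1) by apply/Se/ltp.
  have := bdf2_energy_step dotn kp (r0 i iN) kE wsig cR0 wi w0
    (Se i (lt1 i iN)) Sep eE (Be i iN) (eqe i iN).
  rewrite -/(E i) -/(E i.-1) => h; apply: le_trans h _.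
  apply: lerD; first apply: lerD => //.
    by rewrite -[cR * _ * _]mulrA ler_wpM2l//; exact/SE/lt1.
  have d2 : `|d i| ^+ 2 <= c ^+ 2 * kmax t N ^+ 4.
    apply: (@le_trans _ _ ((c * step t i ^+ 2) ^+ 2)).
      by rewrite lerXn2r// ?nnegrE// ?(le_trans _ (dc i iN))// dc.
    by rewrite exprMn -exprM ler_wpM2l ?sqr_ge0// lerXn2r// nnegrE// ltW.
  have := ler_wpM2l (ltW (mulr_gt0 cR0 ki)) d2; rewrite /y; lra.
have tN m : (m <= N)%N -> forall i, (i < m)%N -> t i < t i.+1.
  by move=> mN i im; apply/tS/(leq_trans im).
have tjn : t j <= t n.
  move: jn; rewrite leq_eqVlt => /predU1P[->//|jn].
  by rewrite ltW// (grid_lt tS)// jn nN.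
have tn0 : 0 <= t n by rewrite -t0 ltW// (grid_lt tS)// n0.
apply: le_trans (SE j ltac:(clear -j2 jn nN; lia)) _.
apply: le_trans (discrete_gronwall j1 c11 E10 rec) _.
rewrite -mulrA; apply: ler_pM.
- exact: expR_ge0.
- rewrite addr_ge0// big_nat sumr_ge0// => i ij.
  by have [] := rec i ij.
- rewrite ler_expR -mulr_sumr mulrA [(1 - c1)^-1 * _]mulrC.
  rewrite ler_wpM2l//; first by rewrite divr_ge0 ?ltW// subr_gt0.
  rewrite [leRHS](@big_cat_nat _ _ _ j.+1)/=; [|exact: leqW|by []].
  rewrite lerDl big_nat sumr_ge0// => i ij.
  by rewrite mulr_ge0 ?sqr_ge0// ltW// k0// ltn//; clear -ij j2; lia.
have cc : 0 <= cR * c ^+ 2 by rewrite mulr_ge0 ?sqr_ge0 ?ltW.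
have sumy : \sum_(2 <= i < j.+1) y i <= cR * c ^+ 2 * (kmax t N ^+ 4 * t n).
  rewrite -mulr_sumr -[leLHS]mulrA ler_wpM2l// ler_wpM2l ?exprn_ge0//.
  by apply: le_trans tjn; apply: sum_step_le => //; apply/tN/(leq_trans jn).
have k1 := k0 1%N l11.
(* Since e^0 = 0, the difference quotient at the first node is e^1/k_1; this is the source of the
   term |e^1|^2/k_1. *)
have dE : step t 1 * `|dbar t e 1| ^+ 2 = (step t 1)^-1 * `|e 1%N| ^+ 2.
  rewrite /dbar/= e0 subr0 normrZ gtr0_norm ?invr_gt0// exprMn; field.
  exact: lt0r_neq0.
have kt0 : 0 <= kmax t N ^+ 4 * t n by rewrite mulr_ge0// exprn_ge0.
have e10 : 0 <= (step t 1)^-1 * `|e 1%N| ^+ 2.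
  by rewrite mulr_ge0 ?sqr_ge0// invr_ge0 ltW.
(* With [sigma <= 1] the claim becomes [p + b + q a <= (1 + q) (a + b + p)] for nonnegative
   quantities. *)
have := ler_wpM2r e10 sig1; have := sqr_ge0 `|S (e 1%N)|.
rewrite /E dE.
move: (kmax t N ^+ 4 * t n) ((step t 1)^-1 * _) (`|S _| ^+ 2) (cR * c ^+ 2)
  kt0 e10 sumy cc => a b p q a0 b0 sumy q0 p0 sb.
nra.
Qed.

(* The arguments of [C] are t^n, gamma, c_1, c_R, c_4, C_2. *)
Theorem theorem4p3 (R : realType) :
  exists C : R -> R -> R -> R -> R -> R -> R,
  forall (H : completeNormedModType R) (dot : {dot H for idfun})
    (A S B : operator H) (T : R) (gamma : R -> R) (gammamax : R)
    (f u du : R -> H) (N : nat) (t : nat -> R) (U : nat -> H)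
    (Rb cR c1 c4 : R),
  let e := fun n => u (t n) - U n in
  let J := [set` `]0, T]] in
  induces_norm dot ->
  self_adjoint dot A -> positive_definite dot A -> is_sqrt_of dot A S ->
  dom S `<=` dom B ->
  (forall s, J s -> 0 <= gamma s) -> smooth_on J gamma ->
  (forall v s, dom S v -> J s -> `|B v| <= gamma s * normV S v) ->
  (gamma @` J) gammamax -> ubound (gamma @` J) gammamax ->
  partition_of T N t ->
  is_solution dot S B T f u du ->
  (forall n, (2 <= n <= N)%N -> `|d2 t u du n| <= c4 * step t n ^+ 2) ->
  (forall n, (1 <= n <= N)%N -> dom S (U n)) ->
  bdf2_scheme dot S B t f N U ->
  e 0%N = 0 ->
  1 < Rb -> Rb < (3 + Num.sqrt 17) / 2 -> rmax t N <= Rb ->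
  Num.max ((2 + 2 * Rb) / (2 + Rb))
          ((2 + 2 * Rb) / (2 + 3 * Rb - Rb ^+ 2)) < cR ->
  cR * gammamax ^+ 2 * kmax t N <= c1 -> c1 < 1 ->
  (forall n, (2 <= n <= N)%N ->
    l2V S t e 2 n ^+ 2 + linftyV S e 2 n ^+ 2
    <= C (t n) gammamax c1 cR c4 (C2 gamma t cR c1 n)
       * (kmax t N ^+ 4 * t n
          + (step t 1)^-1 * `|e 1%N| ^+ 2 + normV S (e 1%N) ^+ 2))
  /\
  (dom S (u 0) ->
   dual_norm_le dot S (d21 dot S B t f u) (c4 * step t 1 ^+ 2) ->
   trapezoidal_step dot S B t f U ->
   (gamma (t 1%N) != 0 -> step t 1 < 3 / gamma (t 1%N) ^+ 2) ->
   forall n, (2 <= n <= N)%N ->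
    l2V S t e 1 n ^+ 2 + linftyV S e 1 n ^+ 2
    <= C (t n) gammamax c1 cR c4 (C2 gamma t cR c1 n)
       * (kmax t N ^+ 4 + step t 1 ^+ 4)).
Proof.
(* The first factor sums the steps in the l^2 norm; D (1 - c1) / cR is the
   exponential in C_2; 16 c4^2 comes from the trapezoidal step. *)
exists (fun tn G c1 cR c4 D =>
  (1 + tn) * (D * (1 - c1) / cR * (1 + cR * c4 ^+ 2) * (1 + tn + 16 * c4 ^+ 2))).
move=> H dot A S B T gamma G f u du N t U Rb cR c1 c4 e J dotn _ _ _ SB gamma0 _
  Bgamma _ GJ part usol d2c SU bdf e0 R1 R17 rR maxc cG c11.
have [N2 t0 tT tS] := part; have [_ Su _ eqU] := usol.
have tJ i : (1 <= i <= N)%N -> t i \in `]0, T].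
  move=> /andP[i1 iN]; rewrite in_itv/= -t0 -tT (grid_lt tS) ?i1//=.
  move: iN; rewrite leq_eqVlt => /predU1P[->//|iN].
  by rewrite ltW// (grid_lt tS)// iN leqnn.
have lt1 i : (2 <= i <= N)%N -> (1 <= i <= N)%N by case/andP => /ltnW->.
have l11 : (1 <= 1 <= N)%N by rewrite leqnn ltnW.
have Sut i : (1 <= i <= N)%N -> dom S (u (t i)) by move=> /tJ /Su.
have Se i : (1 <= i <= N)%N -> dom S (e i).
  by move=> iN; apply: domB; [exact: Sut|exact: SU].
have Be i : (1 <= i <= N)%N -> `|B (e i)| <= gamma (t i) * `|S (e i)|.
  by move=> iN; apply: Bgamma; [exact: Se|exact: tJ].
have gG i : (1 <= i <= N)%N -> 0 <= gamma (t i) <= G.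
  by move=> iN; rewrite gamma0; [apply: GJ; exists (t i) => //|]; exact: tJ.
(* The error equation: subtract the scheme from the differential equation at t^i, where u' is the
   BDF2 quotient of u minus d_2^i. *)
have eqe i : (2 <= i <= N)%N -> forall v, dom S v ->
    dot (dbarB2 t e i) v + extA dot S (e i) v + dot (B (e i)) v
    = dot (d2 t u du i) v.
  move=> iN v Sv; have i1 := lt1 i iN.
  have := eqU _ (tJ i i1) v Sv; have := bdf i iN v Sv.
  have -> : dbarB2 t e i = dbarB2 t (u \o t) i - dbarB2 t U i.
    exact: (dbarB2B t (u \o t) U).
  rewrite /d2 /extA /e opB; [|exact: Sut|exact: SU].
  rewrite (@opB _ _ B); [|exact/SB/Sut|exact/SB/SU].
  rewrite !linearBl/=; lra.
have K0 : 0 <= kmax t N by exact: bigmax_ge_id.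
have k1 : 0 < step t 1 by rewrite subr_gt0; apply/tS/ltnW.
have r2 : 0 < Defs.ratio t 2 by rewrite divr_gt0// subr_gt0; apply: tS.
have r2R : Defs.ratio t 2 <= Rb by apply: le_trans rR; exact: ratio_le_rmax.
have [cR0 _] := weight_bound r2 r2R R1 R17 maxc.
pose K n := expR (cR / (1 - c1) *
    \sum_(2 <= i < n.+1) gamma (t i) ^+ 2 * step t i) * (1 + cR * c4 ^+ 2).
(* Besides giving positivity, [1 <= K n] puts the node [j = 1], not covered by [stab], under the
   same constant. *)
have K1 n : (n <= N)%N -> 1 <= K n.
  move=> nN; rewrite /K -[leLHS]mulr1 ler_pM//.
    rewrite -[leLHS]expR0 ler_expR mulr_ge0 ?divr_ge0 ?(ltW cR0) ?subr_ge0 ?(ltW c11)//.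
    rewrite big_nat sumr_ge0// => i /andP[i2 iN].
    rewrite mulr_ge0 ?sqr_ge0// subr_ge0 ltW// (grid_lt tS)// ltn_predL.
    by rewrite (leq_trans _ i2)// (leq_trans _ nN).
  by rewrite lerDl mulr_ge0 ?sqr_ge0 ?ltW.
have KE n : C2 gamma t cR c1 n * (1 - c1) / cR * (1 + cR * c4 ^+ 2) = K n.
  rewrite /C2 /K; congr (_ * _); rewrite mulrAC -mulrA mulrAC.
  by rewrite mulrA -mulrA; field; rewrite !gt_eqF ?subr_gt0.
have tn0 n : (1 <= n <= N)%N -> 0 <= t n.
  by move=> /tJ; rewrite in_itv/= => /andP[/ltW].
have tSn n : (n <= N)%N -> forall j, (j < n)%N -> t j < t j.+1.
  by move=> nN j jn; apply/tS/(leq_trans jn).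
have stab n j : (n <= N)%N -> (2 <= j <= n)%N ->
    `|S (e j)| ^+ 2 <= K n * (kmax t N ^+ 4 * t n
      + (step t 1)^-1 * `|e 1%N| ^+ 2 + `|S (e 1%N)| ^+ 2).
  move=> nN jn; apply: (bdf2_stability dotn part R1 R17 rR maxc cG c11 _ _ d2c
    Se e0 eqe jn nN) => i /lt1; [exact: gG|exact: Be].
clearbody K.
have ke1 : 0 <= (step t 1)^-1 * `|e 1%N| ^+ 2.
  by rewrite mulr_ge0 ?sqr_ge0// invr_ge0 ltW.
have c40 := sqr_ge0 c4; have K40 : 0 <= kmax t N ^+ 4 by rewrite exprn_ge0.
split=> [n nN|Su0 [z zP zc] trap kg n nN].
  have n1 := lt1 n nN; have [_ nN'] := andP nN; have tn := tn0 n n1.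
  have Kn := K1 n nN'.
  have M0 : 0 <= kmax t N ^+ 4 * t n + (step t 1)^-1 * `|e 1%N| ^+ 2 +
      normV S (e 1%N) ^+ 2.
    by rewrite !addr_ge0 ?sqr_ge0// mulr_ge0.
  have KM0 := mulr_ge0 (le_trans ler01 Kn) M0.
  apply: le_trans (l2V_linftyV_le (m := 2) _ t0 (tSn n nN') KM0 _) _ => //.
    by move=> j jn; apply: stab.
  rewrite KE -[leRHS]mulrA ler_wpM2l ?addr_ge0// -[leRHS]mulrA.
  (* The factor [1 + t n + 16 c4^2] is slack here; it is present because one [C] serves both
     estimates. *)
  by rewrite ler_wpM2l ?(le_trans ler01 Kn)// ler_peMl//; lra.
have n1 := lt1 n nN; have [_ nN'] := andP nN; have tn := tn0 n n1.
have Kn := K1 n nN'.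
have SU0 : dom S (U 0%N).
  by move/eqP: e0; rewrite subr_eq0 t0 => /eqP <-.
have U0E : U 0%N = u (t 0%N) by move/eqP: e0; rewrite subr_eq0 => /eqP <-.
have Smid x y : dom S x -> dom S y -> dom S (midpoint x y).
  by move=> Sx Sy; apply: domZ; rewrite -[x]scale1r; exact: dom_linear.
have mE : midpoint (u (t 1%N)) (u (t 0%N)) - midpoint (U 1%N) (U 0%N)
    = 2^-1 *: e 1%N.
  by rewrite /midpoint U0E -scalerBr opprD addrACA subrr addr0.
have Smu : dom S (midpoint (u (t 1%N)) (u (t 0%N))).
  by apply: Smid; [exact: Sut|rewrite t0].
have SmU : dom S (midpoint (U 1%N) (U 0%N)) by apply: Smid => //; exact: SU.
have e1b : (step t 1)^-1 * `|e 1%N| ^+ 2 + `|S (e 1%N)| ^+ 2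
    <= 16 * c4 ^+ 2 * step t 1 ^+ 4.
  have [g0 _] := andP (gG 1%N l11).
  apply: (trapezoidal_error_bound dotn (g := gamma (t 1%N)) (z := z)) => //.
    exact: Be.
  have Se1 := Se 1%N l11.
  (* [zP] turns the inner product with [z] into the pairing of d_2^1 with e^1; subtracting the
     tested trapezoidal scheme leaves the three error terms. *)
  rewrite zP// /d21; have := trap _ Se1.
  have -> : (step t 1)^-1 * `|e 1%N| ^+ 2 =
      dot (dbar t (u \o t) 1) (e 1%N) - dot (dbar t U 1) (e 1%N).
    rewrite dotn -linearZl_LR/= -linearBl/=; congr (dot _ _).
    by rewrite /dbar -scalerBr/= U0E opprB addrA subrK.
  have -> : 2^-1 * `|S (e 1%N)| ^+ 2 =
      extA dot S (midpoint (u (t 1%N)) (u (t 0%N))) (e 1%N)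
      - extA dot S (midpoint (U 1%N) (U 0%N)) (e 1%N).
    by rewrite /extA -linearBl/= -opB// mE opZ// linearZl_LR/= dotn.
  have -> : 2^-1 * dot (B (e 1%N)) (e 1%N) =
      dot (B (midpoint (u (t 1%N)) (u (t 0%N)))) (e 1%N)
      - dot (B (midpoint (U 1%N) (U 0%N))) (e 1%N).
    rewrite -linearBl/= -opB; [|exact: SB|exact: SB].
    by rewrite mE opZ ?linearZl_LR//; exact: SB.
  lra.
have k40 : 0 <= step t 1 ^+ 4 by rewrite exprn_ge0// ltW.
pose M := K n * (1 + t n + 16 * c4 ^+ 2) * (kmax t N ^+ 4 + step t 1 ^+ 4).
have ck : 0 <= c4 ^+ 2 * kmax t N ^+ 4 by rewrite mulr_ge0.
have ck1 : 0 <= c4 ^+ 2 * step t 1 ^+ 4 by rewrite mulr_ge0.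
have tk : 0 <= t n * kmax t N ^+ 4 by rewrite mulr_ge0.
have tk1 : 0 <= t n * step t 1 ^+ 4 by rewrite mulr_ge0.
have M0 : 0 <= M by rewrite !mulr_ge0 ?(le_trans ler01 Kn)//; lra.
rewrite KE -mulrA -/M.
apply: l2V_linftyV_le => // [|j /andP[j1 jn]]; first exact: tSn.
have [j2|j2] := leqP 2 j.
  apply: le_trans (stab n j nN' _) _; first by rewrite j2.
  rewrite /M -[leRHS]mulrA ler_wpM2l ?(le_trans ler01 Kn)//; lra.
(* At the first node [e1b] alone bounds the error. *)
have -> : j = 1%N by apply/eqP; rewrite eqn_leq j1 -ltnS j2.
apply: (@le_trans _ _
  ((1 + t n + 16 * c4 ^+ 2) * (kmax t N ^+ 4 + step t 1 ^+ 4))).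
  lra.
rewrite /M -mulrA ler_peMl// mulr_ge0//; lra.
Qed.
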